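(* Every Kneser graph $G$ contains the complete graph $K_{\chi(G)}$ as a totally odd subdivision, where $\chi(G)$ denotes the chromatic number of $G$.
   Context: All graphs are finite, undirected and loopless. Write $[n]=\{1,\dots,n\}$. For integers $n\ge k\ge 1$, the Kneser graph $KG(n,k)$ has as vertices all $k$-element subsets of $[n]$, two of them being adjacent if and only if their intersection is empty. A Kneser graph is a graph of the form $KG(n,k)$. A graph $G$ contains a graph $H$ as a totally odd subdivision if there are an injection $\varphi\colon V(H)\to V(G)$ and, for every edge $uv\in E(H)$, a path $P_{uv}$ in $G$ with endpoints $\varphi(u)$ and $\varphi(v)$ and of odd length (number of edges), such that the paths $P_{uv}$ ($uv\in E(H)$) are pairwise edge-disjoint and pairwise internally vertex-disjoint, and no vertex of $\varphi(V(H))$ (these vertices are called terminals) is an internal vertex of any of these paths. *)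

(* Defs.v *)
From mathcomp Require Import all_boot.

Set Implicit Arguments.
Unset Strict Implicit.
Unset Printing Implicit Defensive.

Record sgraph := SGraph {
  vertex :> finType;
  adj : rel vertex;
  adj_sym : symmetric adj;
  adj_irrefl : irreflexive adj }.

Arguments adj {s} x y : rename.

Definition edges (G : sgraph) : {set {set G}} :=
  [set e : {set G} | [exists x, exists y, adj x y && (e == [set x; y])]].

Definition colorable (G : sgraph) (c : nat) : bool :=
  [exists f : {ffun G -> 'I_c}, forall x, forall y, adj x y ==> (f x != f y)].

Lemma ex_colorable (G : sgraph) : exists c, colorable G c.
Proof.
exists #|G|; apply/existsP; exists [ffun x => enum_rank x].
apply/forallP=> x; apply/forallP=> y; apply/implyP=> xy; rewrite !ffunE.
by apply: contraTneq xy => /enum_rank_inj ->; rewrite adj_irrefl.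
Qed.

Definition chi (G : sgraph) : nat := ex_minn (ex_colorable G).

Definition complete_adj (n : nat) : rel 'I_n := fun i j => i != j.

Lemma complete_adj_sym n : symmetric (@complete_adj n).
Proof. by move=> i j; rewrite /complete_adj eq_sym. Qed.

Lemma complete_adj_irrefl n : irreflexive (@complete_adj n).
Proof. by move=> i; rewrite /complete_adj eqxx. Qed.

Definition complete (n : nat) : sgraph :=
  SGraph (@complete_adj_sym n) (@complete_adj_irrefl n).

Definition kneser_vertex (n k : nat) : finType := {A : {set 'I_n} | #|A| == k}.

Definition kneser_adj (n k : nat) : rel (kneser_vertex n k) :=
  fun A B => val A :&: val B == set0.

Lemma kneser_adj_sym n k : symmetric (@kneser_adj n k).
Proof. by move=> A B; rewrite /kneser_adj setIC. Qed.

Lemma kneser_adj_irrefl n k : 0 < k -> irreflexive (@kneser_adj n k).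
Proof.
move=> k_gt0 A; rewrite /kneser_adj setIid -cards_eq0 (eqP (valP A)).
by rewrite eqn0Ngt k_gt0.
Qed.

(* The proof of 0 < k is needed: for k = 0 the only vertex is the empty set,
   which is disjoint from itself. *)
Definition kneser (n k : nat) (k_gt0 : 0 < k) : sgraph :=
  SGraph (@kneser_adj_sym n k) (@kneser_adj_irrefl n k k_gt0).

(* A path is the sequence of its vertices, both endpoints included. *)
Definition path_from_to (G : sgraph) (x y : G) (p : seq G) : bool :=
  [&& uniq p, sorted adj p, ohead p == Some x & last x p == y].

(* Paths are undirected: p may list its vertices starting from either end. *)
Definition path_joining (G : sgraph) (x y : G) (p : seq G) : bool :=
  path_from_to x y p || path_from_to y x p.

Definition path_length (G : sgraph) (p : seq G) : nat := (size p).-1.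

Definition path_edges (G : sgraph) (p : seq G) : seq {set G} :=
  [seq [set xy.1; xy.2] | xy <- zip p (behead p)].

Definition internal_vertices (G : sgraph) (p : seq G) : seq G :=
  if p is x :: q then behead (belast x q) else [::].

(* The path of the edge uv is P [set u; v]; the values of P outside edges H
   are irrelevant. *)
Definition contains_totally_odd_subdivision (G H : sgraph) : Prop :=
  exists (phi : H -> G) (P : {set H} -> seq G),
    [/\ injective phi,
        forall u v : H, adj u v ->
          path_joining (phi u) (phi v) (P [set u; v]) /\
          odd (path_length (P [set u; v])),
        forall e f : {set H}, e \in edges H -> f \in edges H -> e != f ->
          [disjoint path_edges (P e) & path_edges (P f)],
        forall e f : {set H}, e \in edges H -> f \in edges H -> e != f ->
          [disjoint internal_vertices (P e) & internal_vertices (P f)]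
      & forall (e : {set H}) (w : H), e \in edges H ->
          phi w \notin internal_vertices (P e)].

(* Main.v *)
Require Import Defs.
From mathcomp Require Import all_boot zify.

(** Write [k = r + 1] and [t = n - 2k + 2]. Colouring sets by their elements
    shows that the chromatic number of the Kneser graph is at most [t] (or [1]
    if [n < 2k - 1]), so it suffices to find a totally odd subdivision of the
    complete graph on [t] vertices, and then to forget terminals. The ground set
    has [n = t + 2r] points; view it as [t] labels together with [r] pairs of
    points. A label together with a binary word of length [r], which selects one
    point from each pair, is a vertex, and two such vertices with different
    labels and complementary words are adjacent.

    If [t <= r + 1], the terminals are the pairs of a label and the all-false
    word (lemma [layer_web]). Within the layer of a label [i] one can change a
    single letter of the word in two steps, through a vertex that omits the pair
    concerned and uses two labels instead of one. These two labels can be chosen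
    so that the layers stay disjoint; each layer then contains a subdivided
    cube. The path from [i] to [j] walks in layer [i] from the all-false word to
    some word [u], jumps to the complement of [u] in layer [j], and walks back to
    the all-false word there; its length is even plus one plus even. Taking for
    [u] suitable cyclic intervals of positions, with the walks switching letters
    in cyclic order, makes all walks within one layer disjoint. This needs
    [t >= 3]; for [t <= 2] the terminals can be taken adjacent.

    If [t > r + 1], choose a block [B] of [r + 2] labels (lemma
    [kneser_web_add_block]). By induction, the other points carry a web with
    [t - (r + 2)] terminals. The [r + 2] subsets of [B] of size [r + 1] are new
    terminals, adjacent to everything outside [B], in particular to the old
    terminals. Two of them, [B - a] and [B - b], are joined by the path
    [B - a], [a + E], [b + E'], [B - b], where [E] and [E'] are complementary
    transversals of the pairs; all inner vertices meet [B], hence avoid the old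
    web. It remains to choose the words of [E], as thresholds, such that the
    vertices [a + E] are different for different [b] (lemma [block_word_inj]).
    This fails only for [r = 0], where the Kneser graph is itself complete. *)

Set Implicit Arguments.
Unset Strict Implicit.
Unset Printing Implicit Defensive.

(** * Webs *)

(** Each path of a totally odd subdivision of the complete graph on [J] is cut
    at one of its edges into two arms: the path from [phi i] to [phi j] runs
    through [phi i], [arm i j], the reversal of [arm j i], and [phi j]. Indexing
    by ordered pairs makes the situation symmetric in [i] and [j], so that no
    orientation of the edges has to be chosen; [web_parity] says that the path
    has odd length. The predicate [P], which holds on all vertices of the web,
    records on which part of [V] the web lives. *)
Record web (V J : eqType) (P : pred V) (e : rel V)
    (phi : J -> V) (arm : J -> J -> seq V) : Prop := Web {
  web_terminal : forall i, P (phi i);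
  web_arm : forall i j, i != j -> all P (arm i j);
  web_path : forall i j, i != j -> path e (phi i) (arm i j);
  web_meet : forall i j, i != j ->
    e (last (phi i) (arm i j)) (last (phi j) (arm j i));
  web_parity : forall i j, i != j -> odd (size (arm i j)) = odd (size (arm j i));
  web_inj : injective phi;
  web_uniq : forall i j, i != j -> uniq (arm i j);
  web_avoid : forall i j l, i != j -> phi l \notin arm i j;
  web_disjoint : forall i j i' j' v, i != j -> i' != j' ->
    v \in arm i j -> v \in arm i' j' -> i = i' /\ j = j' }.

(** Used to enlarge or rename the ground set (through [f]), to forget terminals
    (through [g]), and to pass from sets to vertices of a Kneser graph. *)
Lemma web_map (V1 V2 J1 J2 : eqType) (P1 : pred V1) (P2 : pred V2)
    (e1 : rel V1) (e2 : rel V2) (f : V1 -> V2) (g : J2 -> J1) phi arm :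
    injective g -> {in P1, forall x, P2 (f x)} -> {in P1 &, injective f} ->
    {in P1 &, {homo f : x y / e1 x y >-> e2 x y}} ->
  web P1 e1 phi arm ->
  web P2 e2 (fun i => f (phi (g i))) (fun i j => map f (arm (g i) (g j))).
Proof.
move=> g_inj fP f_inj f_homo.
case=> Pphi Parm arm_path meet parity phi_inj arm_uniq avoid disj.
have gN i j : i != j -> g i != g j by rewrite (inj_eq g_inj).
have inP i j v : i != j -> v \in arm (g i) (g j) -> v \in P1.
  by move=> /gN/Parm/allP sub /sub.
have lastP i j : i != j -> last (phi (g i)) (arm (g i) (g j)) \in P1.
  move=> ij; have := mem_last (phi (g i)) (arm (g i) (g j)).
  by rewrite inE => /predU1P[-> | /(inP _ _ _ ij)//]; apply: Pphi.
split=> [i | i j ij | i j ij | i j ij | i j ij | i j | i j ij | i j l ij |].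
- exact/fP/Pphi.
- by apply/allP=> _ /mapP[v /(inP _ _ _ ij)/fP Pfv ->].
- rewrite path_map.
  apply: (sub_in_path f_homo); last exact/arm_path/gN.
  by apply/andP; split; [apply: Pphi | apply/allP=> v /(inP _ _ _ ij)].
- rewrite !last_map; apply: f_homo; last exact/meet/gN.
  + exact: lastP.
  + by apply: lastP; rewrite eq_sym.
- by rewrite !size_map; apply/parity/gN.
- by move/(f_inj _ _ (Pphi _) (Pphi _))/phi_inj/g_inj.
- rewrite map_inj_in_uniq; first exact/arm_uniq/gN.
  by move=> u v /(inP _ _ _ ij) Pu /(inP _ _ _ ij) Pv; apply: f_inj.
- apply/mapP=> -[v v_arm /(f_inj _ _ (Pphi _) (inP _ _ _ ij v_arm)) phi_v].
  by move: (avoid _ _ (g l) (gN _ _ ij)); rewrite phi_v v_arm.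
- move=> i j i' j' v ij ij' /mapP[x xin ->] /mapP[y yin] fxy.
  have xy : x = y by apply: f_inj fxy; [apply: inP ij _ | apply: inP ij' _].
  rewrite -xy in yin.
  by have [/g_inj-> /g_inj->] := disj _ _ _ _ _ (gN _ _ ij) (gN _ _ ij') xin yin.
Qed.

Definition sum_arm (J1 J2 T : Type) (d : T) (f1 : J1 -> J1 -> T)
    (f2 : J2 -> J2 -> T) (u v : J1 + J2) : T :=
  match u, v with
  | inl i, inl j => f1 i j
  | inr i, inr j => f2 i j
  | _, _ => d
  end.

(** If every terminal of one web is adjacent to every terminal of another one,
    the mixed pairs are joined by single edges and need no arms; the predicates
    [P1] and [P2] keep the two webs disjoint. *)
Lemma web_join (V J1 J2 : eqType) (P1 P2 : pred V) (e : rel V) phi1 arm1 phi2 arm2 :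
    symmetric e -> (forall v, P1 v -> P2 v -> False) ->
    (forall i j, e (phi1 i) (phi2 j)) ->
  web P1 e phi1 arm1 -> web P2 e phi2 arm2 ->
  web (predU P1 P2) e
    (fun u : J1 + J2 => match u with inl i => phi1 i | inr j => phi2 j end)
    (sum_arm [::] arm1 arm2).
Proof.
move=> e_sym P12 e12 w1 w2.
have in1 i j v : i != j -> v \in arm1 i j -> P1 v.
  by move=> /(web_arm w1)/allP sub /sub.
have in2 i j v : i != j -> v \in arm2 i j -> P2 v.
  by move=> /(web_arm w2)/allP sub /sub.
split.
- by case=> i /=; rewrite ?(web_terminal w1) ?(web_terminal w2) ?orbT.
- case=> i [] j //= ij; apply/allP=> v; first by move/(in1 _ _ _ ij) => /= ->.
  by move/(in2 _ _ _ ij) => /= ->; rewrite orbT.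
- by case=> i [] j //= ij; [apply: (web_path w1) | apply: (web_path w2)].
- case=> i [] j //= ij; [exact: (web_meet w1) | | exact: (web_meet w2)].
  by rewrite e_sym.
- by case=> i [] j //= ij; [exact: (web_parity w1) | exact: (web_parity w2)].
- case=> i [] j /= ephi; do ?[by rewrite (web_inj w1 ephi) | by rewrite (web_inj w2 ephi)].
  + by case: (P12 (phi1 i)); rewrite ?(web_terminal w1) ?ephi ?(web_terminal w2).
  + by case: (P12 (phi1 j)); rewrite ?(web_terminal w1) -?ephi ?(web_terminal w2).
- by case=> i [] j //= ij; [apply: (web_uniq w1) | apply: (web_uniq w2)].
- case=> i [] j [] l //= ij; do ?[exact: (web_avoid w1) | exact: (web_avoid w2)].
  + by apply/negP=> /(in1 _ _ _ ij)/P12; apply; apply: (web_terminal w2).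
  + by apply/negP=> /(in2 _ _ _ ij); apply/P12/(web_terminal w1).
- case=> i [] j [] i' [] j' v //= ij ij' vij vij'.
  + by case: (web_disjoint w1 ij ij' vij vij') => -> ->.
  + by case: (P12 v); [apply: in1 ij vij | apply: in2 ij' vij'].
  + by case: (P12 v); [apply: in1 ij' vij' | apply: in2 ij vij].
  + by case: (web_disjoint w2 ij ij' vij vij') => -> ->.
Qed.

Lemma web_sub (V J : eqType) (P1 P2 : pred V) (e : rel V) (phi : J -> V) arm :
  subpred P1 P2 -> web P1 e phi arm -> web P2 e phi arm.
Proof.
move=> P12 [Pphi Parm *]; split=> // [i | i j ij]; first exact/P12/Pphi.
exact: sub_all P12 _ (Parm i j ij).
Qed.

(** * From webs to subdivisions *)

Lemma mem_zip_behead (T : eqType) (e : rel T) (p : seq T) x y :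
  sorted e p -> (x, y) \in zip p (behead p) -> [/\ e x y, x \in p & y \in p].
Proof.
case: p => // a p; elim: p a => // b p IHp a /= /andP[ab pth].
rewrite inE => /predU1P[[-> ->] | xyp]; first by rewrite !inE !eqxx orbT.
have [exy xp yp] := IHp b pth xyp.
by split=> //; apply: (@mem_behead _ (a :: b :: p)).
Qed.

Section Linkage.

Variables (G : sgraph) (J : finType) (phi : J -> G) (arm : J -> J -> seq G).
Hypothesis W : web predT adj phi arm.

Definition link (a b : J) : seq G := phi a :: arm a b ++ rev (phi b :: arm b a).

(** A subdivision assigns a path to the unordered pair [e]; either orientation
    of [e] may be picked, since paths may be listed from either end. *)
Definition link_of (e : {set J}) : seq G :=
  if [pick ab : J * J | (ab.1 != ab.2) && (e == [set ab.1; ab.2])] is Some ab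
  then link ab.1 ab.2 else [::].

Lemma link_of_pair a b : a != b ->
  exists c d, [/\ c != d, [set a; b] = [set c; d] & link_of [set a; b] = link c d].
Proof.
move=> ab; rewrite /link_of; case: pickP => [[c d] /= /andP[cd /eqP eab] | /(_ (a, b))].
  by exists c, d.
by rewrite /= ab eqxx.
Qed.

Lemma internal_link a b :
  internal_vertices (link a b) = arm a b ++ rev (arm b a).
Proof. by rewrite /link /= rev_cons -rcons_cat belast_rcons. Qed.

Lemma odd_link a b : a != b -> odd (path_length (link a b)).
Proof.
move=> ab; rewrite /path_length /= size_cat size_rev /= addnS /= oddD.
by rewrite (web_parity W ab) addbb.
Qed.

Lemma link_path a b : a != b -> path_from_to (phi a) (phi b) (link a b).
Proof.
move=> ab; have ba : b != a by rewrite eq_sym.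
apply/and4P; split=> //.
- rewrite /link cons_uniq mem_cat mem_rev inE (negPf (web_avoid W _ ab)).
  rewrite (inj_eq (web_inj W)) (negPf ab) (negPf (web_avoid W _ ba)) /=.
  rewrite cat_uniq (web_uniq W ab) rev_uniq cons_uniq (web_avoid W _ ba).
  rewrite (web_uniq W ba) !andbT; apply/hasPn=> v; rewrite mem_rev inE.
  case/predU1P=> [-> /= | vba]; first exact: (web_avoid W b ab).
  apply/negP=> vab; have [eab _] := web_disjoint W ab ba vab vba.
  by rewrite eab eqxx in ab.
- rewrite /link /= cat_path (web_path W ab) /=.
  have := web_path W ba; rewrite -[path _ (phi b) _]/(sorted adj (phi b :: arm b a)).
  rewrite -rev_sorted.
  have -> : sorted (fun y x => adj x y) (rev (phi b :: arm b a))
          = sorted adj (rev (phi b :: arm b a)).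
    by apply: eq_sorted => x y; rewrite adj_sym.
  have := web_meet W ab.
  rewrite lastI rev_rcons /= => -> /= pth; exact: pth.
- by rewrite /link last_cons last_cat rev_cons last_rcons.
Qed.

Lemma mem_link a b v : v \in link a b ->
  (exists2 i, i \in [set a; b] & v = phi i) \/ v \in arm a b \/ v \in arm b a.
Proof.
rewrite /link inE mem_cat mem_rev inE.
case/or4P=> [/eqP-> | vab | /eqP-> | vba]; [ | by auto | | by auto].
- by left; exists a; rewrite ?set21.
- by left; exists b; rewrite ?set22.
Qed.

Lemma arm_not_linked a b c d v : a != b -> c != d ->
    [set a; b] != [set c; d] ->
  v \in arm a b -> v \notin link c d.
Proof.
move=> ab cd abcd vab; apply/negP=> /mem_link[[i _ vi] | vcd].
  by move: (web_avoid W i ab); rewrite -vi vab.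
case/negP: abcd; case: vcd => [vcd | vdc].
  by have [-> ->] := web_disjoint W ab cd vab vcd.
have dc : d != c by rewrite eq_sym.
by have [-> ->] := web_disjoint W ab dc vab vdc; rewrite setUC.
Qed.

(** Two paths of the web meet only in common terminals. Both disjointness
    conditions of a subdivision follow from this: a common edge would give two
    common terminals, hence the same pair. *)
Lemma linked_twice a b c d v : a != b -> c != d ->
    [set a; b] != [set c; d] -> v \in link a b -> v \in link c d ->
  exists2 i, i \in [set a; b] :&: [set c; d] & v = phi i.
Proof.
move=> ab cd abcd vab vcd.
have ba : b != a by rewrite eq_sym.
case: (mem_link vab) => [[i iab vi] | [v_arm | v_arm]].
- case: (mem_link vcd) => [[j jcd vj] | [v_arm | v_arm]].
  + by exists i; rewrite // inE iab /= (web_inj W (etrans (esym vi) vj)).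
  + by move: (web_avoid W i cd); rewrite -vi v_arm.
  + by have dc : d != c by [rewrite eq_sym]; move: (web_avoid W i dc); rewrite -vi v_arm.
- by move: (arm_not_linked ab cd abcd v_arm); rewrite vcd.
- by rewrite setUC in abcd; move: (arm_not_linked ba cd abcd v_arm); rewrite vcd.
Qed.

End Linkage.

Lemma web_subdivision (G : sgraph) (m : nat) (phi : 'I_m -> G) arm :
  web predT adj phi arm -> contains_totally_odd_subdivision G (complete m).
Proof.
move=> W; exists phi, (link_of phi arm).
have edgeP (e : {set complete m}) : e \in edges (complete m) ->
    exists a b, [/\ a != b, e = [set a; b] & link_of phi arm e = link phi arm a b].
  rewrite inE => /existsP[u /existsP[v /andP[uv /eqP->]]].
  exact: link_of_pair.
split; first exact: web_inj W.
- move=> u v uv; have [a [b [ab eab ->]]] := link_of_pair phi arm uv.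
  split; last exact: odd_link W _ _ ab.
  have : u \in [set a; b] by rewrite -eab set21.
  have : v \in [set a; b] by rewrite -eab set22.
  rewrite /path_joining !inE => /orP[]/eqP vE /orP[]/eqP uE.
  + by move: uv; rewrite /= /complete_adj vE uE eqxx.
  + by rewrite vE uE (link_path W ab) orbT.
  + by rewrite vE uE (link_path W ab).
  + by move: uv; rewrite /= /complete_adj vE uE eqxx.
- move=> e f /edgeP[a [b [ab -> ->]]] /edgeP[c [d [cd -> ->]]] abcd.
  apply/pred0P=> g /=; apply/negbTE/negP=> /andP[/mapP[[x y] xy ->] /mapP[[x' y'] xy']].
  have [_ so _ _] := and4P (link_path W ab); have [_ so' _ _] := and4P (link_path W cd).
  have [adjxy xab yab] := mem_zip_behead so xy.
  have [_ xcd ycd] := mem_zip_behead so' xy'.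
  move=> /= exy.
  have sub z : z \in [set x; y] -> z \in link phi arm c d.
    by rewrite exy !inE => /orP[]/eqP->.
  have [i iI xi] := linked_twice W ab cd abcd xab (sub _ (set21 x y)).
  have [j jI yj] := linked_twice W ab cd abcd yab (sub _ (set22 x y)).
  have ij : i != j by apply: contraTneq adjxy => ij; rewrite xi yj ij adj_irrefl.
  have cardI : 1 < #|[set a; b] :&: [set c; d]|.
    have: [set i; j] \subset [set a; b] :&: [set c; d].
      by rewrite subUset !sub1set iI jI.
    by move/subset_leq_card; rewrite cards2 ij.
  case/negP: abcd; rewrite eqEcard !cards2 ab cd leqnn andbT.
  apply/setIidPl/eqP; rewrite eqEcard subsetIl cards2 ab //.
- move=> e f /edgeP[a [b [ab -> ->]]] /edgeP[c [d [cd -> ->]]] abcd.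
  rewrite !internal_link; apply/pred0P=> v /=; apply/negbTE/negP=> /andP[vab vcd].
  have in_link u w : v \in arm u w ++ rev (arm w u) -> v \in link phi arm u w.
    by rewrite /link inE !mem_cat !mem_rev inE => /orP[] ->; rewrite !orbT.
  have [i _ vi] := linked_twice W ab cd abcd (in_link _ _ vab) (in_link _ _ vcd).
  have ba : b != a by rewrite eq_sym.
  move: vab; rewrite mem_cat mem_rev vi.
  by rewrite (negPf (web_avoid W i ab)) (negPf (web_avoid W i ba)).
- move=> e w /edgeP[a [b [ab _ ->]]]; have ba : b != a by rewrite eq_sym.
  rewrite internal_link mem_cat mem_rev.
  by rewrite (negPf (web_avoid W w ab)) (negPf (web_avoid W w ba)).
Qed.

(** * The easy upper bound on the chromatic number *)

Lemma colorable_chi (G : sgraph) c : colorable G c -> chi G <= c.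
Proof. by rewrite /chi; case: ex_minnP => m _ min_m /min_m. Qed.

(** Colour a set by one of its elements below [N], or by [N] if it has none.
    Disjoint sets do not share an element, and the sets of the last class lie
    in the fewer than [2k] remaining points, so two of them always meet. The
    truncated subtractions also give the bound [1] when [n < 2k - 1]. *)
Lemma chi_kneser (n k : nat) (k_gt0 : 0 < k) :
  chi (kneser n k_gt0) <= (n - k.*2.-1).+1.
Proof.
set N := n - _.
have small (A : kneser_vertex n k) :
    (forall x, x \in val A -> N <= x) -> forall B : kneser_vertex n k,
    (forall x, x \in val B -> N <= x) -> val A :&: val B != set0.
  move=> NA B NB; apply/negP=> /eqP AB0.
  have AB : #|val A :|: val B| = k.*2.
    by rewrite cardsU AB0 cards0 subn0 (eqP (valP A)) (eqP (valP B)) addnn.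
  have sub : val A :|: val B \subset [set x : 'I_n | N <= x].
    by apply/subsetP=> x; rewrite !inE => /orP[/NA | /NB].
  have cN : #|[set x : 'I_n | N <= x]| <= n - N.
    rewrite cardE -(size_map val) -[leqRHS](size_iota N).
    rewrite uniq_leq_size ?(map_inj_uniq val_inj) ?enum_uniq //.
    move=> y /mapP[x]; rewrite mem_enum inE => Nx ->; rewrite mem_iota Nx /=.
    by rewrite subnKC ?leq_subr.
  have := leq_trans (subset_leq_card sub) cN; rewrite AB /N; lia.
apply: colorable_chi; apply/existsP.
pose low (A : {set 'I_n}) := [pick x in A | x < N].
have lowP (A : {set 'I_n}) : (if low A is Some x then val x else N) < N.+1.
  by rewrite /low; case: pickP => [x /andP[_ /ltnW] | _].
exists [ffun A => Ordinal (lowP (val A))].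
apply/forallP=> A; apply/forallP=> B; apply/implyP=> /eqP AB0; rewrite !ffunE.
apply/negP=> /eqP/(congr1 val)/=; rewrite /low.
case: pickP => [x /andP[xA xN] | hiA]; case: pickP => [y /andP[yB yN] | hiB].
- by move/val_inj=> xy; move/setP/(_ x): AB0; rewrite !inE xA xy yB.
- by move=> xN'; rewrite xN' ltnn in xN.
- by move=> yN'; rewrite -yN' ltnn in yN.
- have hi (C : {set 'I_n}) : (fun x => (x \in C) && (x < N)) =1 xpred0 ->
      forall x, x \in C -> N <= x.
    by move=> hiC x xC; rewrite leqNgt; move: (hiC x); rewrite xC => /= ->.
  by move: (small A (hi _ hiA) B (hi _ hiB)); rewrite AB0 eqxx.
Qed.

(** * Webs in Kneser graphs *)

Definition disjset (U : finType) : rel {set U} := fun A B => A :&: B == set0.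
Arguments disjset {U} A B.

Definition ksubset (U : finType) k : pred {set U} := fun A => #|A| == k.

Lemma disjset_sym U : symmetric (@disjset U).
Proof. by move=> A B; rewrite /disjset setIC. Qed.

(** The [k]-sets live in a set of [#|J| + 2r] points with [k = r.+1], made of
    one point for each element of [J] and of [r] pairs of points. *)
Notation ground J r := (J + 'I_r * bool)%type.

Section PartialTransversals.

Variables (J : finType) (r : nat).
Implicit Types (C : {set J}) (w : 'I_r -> option bool).

(** The points of [C] together with at most one point from each of the [r]
    pairs, selected by the partial word [w]. *)
Definition ptrans C w : {set ground J r} :=
  [set u | match u with inl i => i \in C | inr xb => w xb.1 == Some xb.2 end].

Lemma in_ptrans_inl C w i : (inl i \in ptrans C w) = (i \in C).
Proof. by rewrite inE. Qed.

Lemma card_ptrans C w : #|ptrans C w| = #|C| + #|[pred x | w x : bool]|.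
Proof.
have -> : ptrans C w =
    inl @: C :|: [set inr (x, odflt false (w x)) | x in [pred x | w x : bool]].
  apply/setP=> -[i | [x b]]; rewrite !inE /=.
  - rewrite (mem_imset _ _ (@inl_inj _ _)).
    by case: imsetP => [[]|]; rewrite ?orbF.
  - case: imsetP => [[]// | _] /=.
    apply/eqP/imsetP=> [wx | [y]]; first by exists x; rewrite ?inE /= ?wx.
    by rewrite inE /=; case wy: (w y) => [c|] //= _ [-> ->].
rewrite cardsU card_imset; last exact: inl_inj.
rewrite card_imset; last by move=> x y [].
rewrite (_ : _ :&: _ = set0) ?cards0 ?subn0 //.
by apply/setP=> u; rewrite !inE; apply/negbTE/andP=> -[/imsetP[i _ ->] /imsetP[]].
Qed.

Lemma card_ptrans_total C (w : 'I_r -> bool) :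
  #|ptrans C (fun x => Some (w x))| = #|C| + r.
Proof. by rewrite card_ptrans (eq_card (B := 'I_r)) // card_ord. Qed.

(** Opposite letters never clash: complementary words give adjacent vertices. *)
Lemma disjset_ptrans C w C' w' : [disjoint C & C'] ->
  (forall x b, w x = Some b -> w' x = Some b -> False) ->
  disjset (ptrans C w) (ptrans C' w').
Proof.
move=> CC' ww'; apply/eqP/setP=> -[i | [x b]]; rewrite !inE /=.
  by apply/negbTE/andP=> -[iC]; rewrite (disjointFr CC' iC).
by apply/negbTE/andP=> -[/eqP wx /eqP]; apply: ww' wx.
Qed.

Lemma ptrans_inj C w C' w' : ptrans C w = ptrans C' w' -> C = C' /\ w =1 w'.
Proof.
move/setP=> eqCw; split=> [|x].
  by apply/setP=> i; have := eqCw (inl i); rewrite !inE.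
case wx: (w x) => [b|].
  by have := eqCw (inr (x, b)); rewrite !inE /= wx eqxx => /esym/eqP.
case wx': (w' x) => [b|] //.
by have := eqCw (inr (x, b)); rewrite !inE /= wx wx' eqxx.
Qed.

End PartialTransversals.

Lemma card_ground (J : finType) r : #|{: ground J r}| = #|J| + r.*2.
Proof. by rewrite card_sum card_prod card_ord card_bool muln2. Qed.

Lemma exists_injection (T1 T2 : finType) :
  #|T1| <= #|T2| -> exists f : T1 -> T2, injective f.
Proof.
move=> le12; exists (fun x => enum_val (widen_ord le12 (enum_rank x))).
by move=> x y /enum_val_inj/(congr1 val)/= /val_inj/enum_rank_inj.
Qed.

Definition has_kneser_web (U J : finType) k : Prop :=
  exists phi arm, @web {set U} J (ksubset k) disjset phi arm.

Lemma disjset_imset (U1 U2 : finType) (f : U1 -> U2) (A B : {set U1}) :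
  injective f -> disjset A B -> disjset (f @: A) (f @: B).
Proof.
move=> f_inj /eqP AB; rewrite /disjset -imsetI ?AB ?imset0 //.
exact: in2W.
Qed.

Lemma has_kneser_web_leq (U1 U2 J1 J2 : finType) k :
  #|U1| <= #|U2| -> #|J2| <= #|J1| ->
  has_kneser_web U1 J1 k -> has_kneser_web U2 J2 k.
Proof.
move=> /exists_injection[f f_inj] /exists_injection[g g_inj] [phi [arm W]].
exists (fun i => f @: phi (g i)).
exists (fun i j => [seq f @: A | A : {set U1} <- arm (g i) (g j)]).
apply: (web_map (f := fun A : {set U1} => f @: A) g_inj _ _ _ W).
- by move=> A; rewrite /in_mem /= /ksubset card_imset.
- by move=> A B _ _; apply: imset_inj.
- by move=> A B _ _; apply: disjset_imset.
Qed.

(** A constant word and its complement make two terminals adjacent; for [r = 0]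
    there are no letters and all singletons are adjacent. *)
Lemma kneser_web_direct m r :
  r = 0 \/ m <= 2 -> has_kneser_web (ground 'I_m r) 'I_m r.+1.
Proof.
move=> small; pose c (i : 'I_m) := val i == 0.
have cN i j : i != j -> 0 < r -> c i != c j.
  case: small => [-> // | m2]; rewrite -(inj_eq val_inj) /c /=.
  have := ltn_ord i; have := ltn_ord j; lia.
exists (fun i => ptrans [set i] (fun x => Some (c i))), (fun _ _ => [::]).
have card_phi i : #|@ptrans 'I_m r [set i] (fun x => Some (c i))| == r.+1.
  by rewrite card_ptrans_total cards1.
split=> //=.
- move=> i j ij; apply: disjset_ptrans => [|x b [<-] []].
    by rewrite disjoints1 inE.
  have r_gt0 : 0 < r := leq_ltn_trans (leq0n _) (ltn_ord x).
  by move=> cji; have := cN _ _ ij r_gt0; rewrite -/(c j) cji eqxx.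
- by move=> i j /ptrans_inj[/set1_inj].
Qed.

(** * Adding a block of terminals *)

Section Block.

Variables (m r : nat).
Hypothesis r_gt0 : 0 < r.
Notation J := ('I_m + 'I_r.+2)%type.

(** For terminals [B - a] and [B - b] in the block [B], the path is
    [B - a], [a + E], [b + E'], [B - b], where [E] and [E'] are complementary
    transversals of the pairs. For [a < b] the word of [E] is true below the
    threshold [b - a]. For fixed [a] the words must differ when [b] varies: an
    increasing and a decreasing word with positive thresholds differ in their
    first letter. The threshold [r + 1] would give the same word as [r]; it only
    occurs for [a = 0], [b = r + 1], and there the constant false word
    (threshold [0]) is available, as [0] has no smaller [b] and [r + 1] no
    larger one. *)
Definition threshold d := if d == r.+1 then 0 else d.

Definition block_word (a b : 'I_r.+2) (x : 'I_r) : bool :=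
  if a < b then x < threshold (b - a) else threshold (a - b) <= x.

Lemma block_wordC a b x : a != b -> block_word b a x = ~~ block_word a b x.
Proof. by rewrite -(inj_eq val_inj) /block_word /=; case: ltngtP => //; lia. Qed.

Lemma block_word_inj a b b' :
  a != b -> a != b' -> block_word a b =1 block_word a b' -> b = b'.
Proof.
rewrite -!(inj_eq val_inj) /= => ab ab' eqw; apply/val_inj => /=.
have eqn x : x < r -> (if a < b then x < threshold (b - a) else threshold (a - b) <= x)
    = (if a < b' then x < threshold (b' - a) else threshold (a - b') <= x).
  by move=> xr; apply: (eqw (Ordinal xr)).
have thr_le d : 0 < d <= r.+1 -> threshold d <= r.
  by rewrite /threshold; do ?case: eqP => ?; lia.
have thr_gt0 d : 0 < d <= r -> 0 < threshold d.
  by rewrite /threshold; do ?case: eqP => ?; lia.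
have thr_inj d d' : 0 < d <= r.+1 -> 0 < d' <= r.+1 ->
    threshold d = threshold d' -> d = d'.
  by rewrite /threshold; do ?case: eqP => ?; lia.
have eq_thr t t' : t <= r -> t' <= r ->
    (forall x, x < r -> (x < t) = (x < t')) -> t = t'.
  by move=> tr tr' eqt; have := eqt t; have := eqt t'; lia.
have := ltn_ord a; have := ltn_ord b; have := ltn_ord b' => b'r br ar.
(* Two words of the same direction are compared through their thresholds, two
   of opposite directions through their first letter. *)
case: (ltnP a b) eqn => h; case: (ltnP a b') => h' eqn.
- suff: b - a = b' - a by lia.
  by apply: thr_inj; [lia | lia | apply: eq_thr => //; apply: thr_le; lia].
- by have := eqn 0 r_gt0; have := thr_gt0 (b - a); have := thr_gt0 (a - b'); lia.
- by have := eqn 0 r_gt0; have := thr_gt0 (b' - a); have := thr_gt0 (a - b); lia.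
- suff: a - b = a - b' by lia.
  apply: thr_inj; [lia | lia | apply: eq_thr => [| | x /eqn]; last by lia].
  all: by apply: thr_le; lia.
Qed.

(** Separates the new vertices from those of a web living outside the block. *)
Definition meets_block : pred {set ground J r} :=
  fun A => [exists b, inl (inr b) \in A].

Lemma block_web :
  web [predI ksubset r.+1 & meets_block] disjset
    (fun a => @ptrans J r (inr @: [set~ a]) (fun _ => None))
    (fun a b => [:: @ptrans J r [set inr a] (fun x => Some (block_word a b x))]).
Proof.
have inr_imset (a : 'I_r.+2) (A : {set 'I_r.+2}) :
  (inr a \in [set (inr x : J) | x in A]) = (a \in A) by rewrite mem_imset //; apply: inr_inj.
split=> /=.
- move=> a; apply/andP; split.
    rewrite /in_mem /= /ksubset card_ptrans card_imset; last exact: inr_inj.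
    by rewrite cardsC1 card_ord eq_card0 ?addn0.
  have /card_gt0P[b] : 0 < #|[set~ a]| by rewrite cardsC1 card_ord.
  by rewrite -inr_imset => ba; apply/existsP; exists b; rewrite in_ptrans_inl.
- move=> a b _; rewrite andbT; apply/andP; split.
    by rewrite /in_mem /= /ksubset card_ptrans_total cards1.
  by apply/existsP; exists a; rewrite in_ptrans_inl set11.
- move=> a b _; rewrite andbT; apply: disjset_ptrans => //.
  by rewrite disjoint_sym disjoints1 inr_imset !inE eqxx.
- move=> a b ab; apply: disjset_ptrans => [|x c [<-] []].
    by rewrite disjoints1 inE; apply: contra ab => /eqP[->].
  by rewrite block_wordC //; case: block_word.
- by [].
- move=> a b /ptrans_inj[/setP/(_ (inr a))]; rewrite !inr_imset !inE eqxx.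
  by move/esym/negbFE/eqP.
- by [].
- move=> a b c _; rewrite inE; apply/eqP=> /ptrans_inj[_ /(_ (Ordinal r_gt0))].
  by [].
- move=> a b a' b' v ab ab'; rewrite !inE => /eqP-> /eqP/ptrans_inj[/set1_inj[aa] eqw].
  subst a'; split=> //; apply: block_word_inj ab ab' _ => x.
  by have [] := eqw x.
Qed.

(** Every new terminal lies in the block, hence is adjacent to every vertex of
    the old web, while every new vertex meets the block. *)
Lemma kneser_web_add_block :
  has_kneser_web (ground 'I_m r) 'I_m r.+1 -> has_kneser_web (ground J r) J r.+1.
Proof.
pose lift (u : ground 'I_m r) : ground J r :=
  match u with inl i => inl (inl i) | inr xb => inr xb end.
have lift_inj : injective lift by case=> [i|x] [j|y] // [->].
pose old := [predI ksubset r.+1 & [predC meets_block]].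
case=> phi [arm W].
have W1 : web old disjset (fun i => lift @: phi i)
    (fun i j => [seq lift @: A | A : {set _} <- arm i j]).
  apply: (web_map (f := fun A : {set _} => lift @: A) (g := id) _ _ _ _ W) => //.
  - move=> A kA; apply/andP; split; first by rewrite /in_mem /= /ksubset card_imset.
    by apply/existsP=> -[b /imsetP[[i|x]]].
  - by move=> A B _ _; apply: imset_inj.
  - by move=> A B _ _; apply: disjset_imset.
have W2 := web_join (@disjset_sym _) _ _ W1 block_web.
eexists _, _; apply: web_sub (W2 _ _) => [A /orP[]/andP[] // | A | i a].
- by case/andP=> _ /negP oldA /andP[_ /oldA].
- apply/eqP/setP=> u; rewrite !inE; apply/negbTE/andP=> -[/imsetP[[j|x] _ ->]] //=.
  by case/imsetP.
Qed.

End Block.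

(** * The layered web *)

Section Rank.

Variable r : nat.

(** The residue of [x - s] modulo [r], for [s, x < r]: the number of steps from
    [s] to [x] around the cycle of the [r] letter positions. *)
Definition rank (s x : nat) : nat := if s <= x then x - s else x + r - s.

Definition unrank (s l : nat) : nat := if s + l < r then s + l else s + l - r.

Lemma rankP s x : s <= x /\ rank s x = x - s \/ x < s /\ rank s x = x + r - s.
Proof. by rewrite /rank; case: leqP; auto. Qed.

Lemma unrankK s l : s < r -> l < r -> unrank s l < r /\ rank s (unrank s l) = l.
Proof. by move=> sr lr; have := rankP s (unrank s l); rewrite /unrank; case: ifP; lia. Qed.

(** A proper nonempty cyclic interval has a unique first position: the
    predecessor of [s] does not belong to the interval starting at [s]. *)
Lemma ranked_word_inj s s' h h' : s < r -> s' < r -> h <= r -> h' <= r -> 0 < h ->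
    (forall x, x < r -> (rank s x < h) = (rank s' x < h')) ->
  h = h' /\ (h < r -> s = s').
Proof.
move=> sr sr' hr hr' h0 eqw.
have r0 : r.-1 < r by lia.
have eqs : h < r -> s = s'.
  move=> hr1; have [ur uK] := unrankK sr r0.
  have s_in : rank s' s < h' by rewrite -eqw //; have := rankP s s; lia.
  have u_out : h' <= rank s' (unrank s r.-1) by rewrite leqNgt -eqw // uK; lia.
  have := rankP s (unrank s r.-1); have := rankP s' (unrank s r.-1).
  by have := rankP s' s; lia.
split=> //; case: (ltnP h r) => hr1.
  have es := eqs hr1; subst s'; have [ur uK] := unrankK sr hr1.
  have le_h'h : h' <= h by rewrite leqNgt -{1}uK -eqw // uK ltnn.
  have [vr vK] := unrankK sr (leq_ltn_trans le_h'h hr1).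
  by apply/eqP; rewrite eqn_leq le_h'h andbT leqNgt -{1}vK eqw // vK ltnn.
case: (ltnP h' r) => hr1'; last by lia.
have [vr vK] := unrankK sr' hr1'.
by have := eqw _ vr; rewrite vK ltnn; have := rankP s (unrank s' h'); lia.
Qed.

(** Here the gap is the position [p] at rank [h] from [s], and the positions
    from [s] to just before [p] carry the letter false. If [s] and [s'] were
    different, each would lie in the interval leading from the other to [p],
    and these two intervals would cover the whole cycle. *)
Lemma ranked_gap_inj s s' h h' : s < r -> s' < r -> h < r -> h' < r ->
    (forall x, x < r -> (rank s x == h) = (rank s' x == h')) ->
    (forall x, x < r -> (h < rank s x) = (h' < rank s' x)) ->
  h = h' /\ s = s'.
Proof.
move=> sr sr' hr hr' eqgap eqw.
have [pr pK] := unrankK sr hr; move: (unrank s h) pr pK => p pr pK.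
have pK' : rank s' p = h' by apply/eqP; rewrite -eqgap // pK.
have s_in : rank s' s <= h' by rewrite leqNgt -eqw //; have := rankP s s; lia.
have s_in' : rank s s' <= h by rewrite leqNgt eqw //; have := rankP s' s'; lia.
have := rankP s p; have := rankP s' p; have := rankP s s'; have := rankP s' s; lia.
Qed.

End Rank.

Section Layers.

Variables (m r : nat).
Hypothesis (m_gt2 : 2 < m) (m_le : m <= r.+1).
Notation J := ('I_m).

(** The vertices of layer [i] in walking order. Starting from the all-false word
    the positions [s], [s + 1], and so on are switched to true one at a time
    around the cycle. Even steps carry the singleton [i] and a full word; the
    odd step in between carries the complementary word with the switched letter
    left out, which is disjoint from both its neighbours, and to keep the number
    of elements it has two points of [J], chosen so that [i] can be read off. *)
Definition layer (i : J) (s q : nat) : {set ground J r} :=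
  if odd q then
    ptrans [set ordS i; ordS (ordS i)]
      (fun x => if rank r s x == q./2 then None else Some (q./2 < rank r s x))
  else ptrans [set i] (fun x => Some (rank r s x < q./2)).

Lemma ordS_cases (i : J) :
  i.+1 = m /\ ordS i = 0 :> nat \/ i.+1 < m /\ ordS i = i.+1 :> nat.
Proof.
case: (ltnP i.+1 m) => im /=; first by rewrite modn_small //; right.
have -> : i.+1 = m by apply/eqP; rewrite eqn_leq im ltn_ord.
by rewrite modnn; left.
Qed.

Lemma ordS_distinct (i : J) :
  [/\ i != ordS i, i != ordS (ordS i) & ordS i != ordS (ordS i)].
Proof.
have := ordS_cases i; have := ordS_cases (ordS i).
move: (ordS (ordS i)) (ordS i) => k j *.
by split; apply/eqP=> /(congr1 (@nat_of_ord m)); lia.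
Qed.

Lemma ordS_inj : injective (@ordS m).
Proof.
move=> i j eqS; apply/val_inj => /=.
by have := ordS_cases i; have := ordS_cases j; rewrite eqS; move: (ordS j) => k; lia.
Qed.

(** Two cyclically consecutive points have a well-defined first one because the
    cycle has length at least 3. *)
Lemma ordS_pair_inj (i j : J) :
  [set ordS i; ordS (ordS i)] = [set ordS j; ordS (ordS j)] -> i = j.
Proof.
move=> eqS; have [iS iSS _] := ordS_distinct i.
have: ordS i \in [set ordS j; ordS (ordS j)] by rewrite -eqS set21.
have: ordS j \in [set ordS i; ordS (ordS i)] by rewrite eqS set21.
rewrite !inE => /orP[/eqP/ordS_inj-> // | /eqP/ordS_inj ->].
by case/orP=> /eqP/ordS_inj/eqP; rewrite ?(negPf iS) ?(negPf iSS).
Qed.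

Lemma layer_card i s q : s < r -> q <= r.*2 -> #|layer i s q| = r.+1.
Proof.
move=> sr qr; have [_ _ SS] := ordS_distinct i.
rewrite /layer; case: ifP => oddq; last by rewrite card_ptrans_total cards1.
rewrite card_ptrans cards2 SS.
have hr : q./2 < r by move: qr; rewrite -[q in q <= _]odd_double_half oddq; lia.
have [pr pK] := unrankK sr hr.
rewrite (eq_card (B := predC1 (Ordinal pr))); first by rewrite cardC1 card_ord; lia.
move=> x; rewrite !inE -(inj_eq val_inj) /=.
have -> : (rank r s x == q./2) = (x == unrank r s q./2 :> nat).
  apply/eqP/eqP=> [xK | -> //]; have := rankP r s x; have := rankP r s (unrank r s q./2).
  by have := ltn_ord x; lia.
by case: eqP.
Qed.

Lemma layer_step i s q : disjset (layer i s q) (layer i s q.+1).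
Proof.
have [iS iSS _] := ordS_distinct i.
have sing : [disjoint [set i] & [set ordS i; ordS (ordS i)]].
  by rewrite disjoints1 !inE negb_or iS iSS.
rewrite /layer /= uphalf_half; case: (boolP (odd q)) => oddq /=; apply: disjset_ptrans.
- by rewrite disjoint_sym.
- by move=> x b; case: eqP => // xq [<-] []; lia.
- by [].
- by move=> x b [<-]; case: eqP => // xq []; lia.
Qed.

(** The part in [J] shows the layer and the parity of the step, the word shows
    the rest, except for the all-true word, which does not show the start. *)
Lemma layer_inj i i' s s' q q' :
    s < r -> s' < r -> q <= r.*2 -> q' <= r.*2 -> 0 < q ->
    layer i s q = layer i' s' q' ->
  [/\ i = i', q = q' & q < r.*2 -> s = s'].
Proof.
move=> sr sr' qr qr' q0.
have [_ _ SS] := ordS_distinct i; have [_ _ SS'] := ordS_distinct i'.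
rewrite /layer; case: ifP => oq; case: ifP => oq' /ptrans_inj[eqC eqw].
- have eqg : forall x, x < r -> (rank r s x == q./2) = (rank r s' x == q'./2).
    move=> x xr; have := eqw (Ordinal xr) => /=.
    by case: eqP; case: eqP.
  have eqlt : forall x, x < r -> (q./2 < rank r s x) = (q'./2 < rank r s' x).
    move=> x xr; have := eqw (Ordinal xr) => /=.
    by case: eqP => [-> | _]; case: eqP => [-> | _] //; [rewrite !ltnn | case].
  have [||eqh eqs] := ranked_gap_inj sr sr' _ _ eqg eqlt; try lia.
  by split=> //; [apply: ordS_pair_inj | lia].
- by have := congr1 (fun A : {set J} => #|A|) eqC; rewrite /= cards2 SS cards1.
- by have := congr1 (fun A : {set J} => #|A|) eqC; rewrite /= cards2 SS' cards1.
- have eqlt : forall x, x < r -> (rank r s x < q./2) = (rank r s' x < q'./2).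
    by move=> x xr; have [] := eqw (Ordinal xr).
  have [||| eqh eqs] := ranked_word_inj sr sr' _ _ _ eqlt; try lia.
  by split; [exact/set1_inj | lia | move=> *; apply: eqs; lia].
Qed.

(** The letter positions are the labels [0, ..., r - 1]; the label [r] is
    exceptional. For [i, j < r], the arm of [i] towards [j] switches the cyclic
    interval from [j] up to but excluding [i], and the arm of [j] towards [i]
    switches the complementary interval, so that the two arms end in adjacent
    vertices. In layer [i] the starting position [i] remains; it is used for an
    arm all around the cycle to the all-true word, which is adjacent to the
    terminal of the label [r] itself. *)
Definition arm_start (i j : nat) := if j == r then i else j.
Definition arm_steps (i j : nat) :=
  if j == r then r else if i == r then 0 else rank r j i.
Definition layer_arm (i j : J) :=
  [seq layer i (arm_start i j) q | q <- iota 1 (arm_steps i j).*2].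

Lemma path_map_iota (T : Type) (e : rel T) (F : nat -> T) a n :
  (forall q, e (F q) (F q.+1)) -> path e (F a) [seq F q | q <- iota a.+1 n].
Proof. by move=> step; elim: n a => //= n IHn a; rewrite step IHn. Qed.

Lemma last_map_iota (T : Type) (F : nat -> T) a n :
  last (F a) [seq F q | q <- iota a.+1 n] = F (a + n).
Proof. by elim: n a => [a | n IHn a] /=; rewrite ?addn0 // IHn addSnnS. Qed.

Lemma layer0 i s : layer i s 0 = layer i 0 0.
Proof. by apply/setP=> -[j|[x b]]; rewrite !inE. Qed.

Lemma layer_web : web (ksubset r.+1) disjset (fun i => layer i 0 0) layer_arm.
Proof.
have r_gt0 : 0 < r by lia.
have ord_neq (i j : J) : i != j -> i <> j :> nat.
  by move/eqP=> ij; contradict ij; apply/val_inj.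
have start_lt (i j : J) : i != j -> arm_start i j < r.
  move/ord_neq; rewrite /arm_start; have := ltn_ord i; have := ltn_ord j.
  by case: eqP; lia.
have steps_le (i j : J) : i != j -> arm_steps i j <= r.
  move/ord_neq; rewrite /arm_steps /rank; have := ltn_ord i; have := ltn_ord j.
  by do !case: ifP; lia.
have in_arm (i j : J) v : i != j -> v \in layer_arm i j ->
    exists2 q, 0 < q <= (arm_steps i j).*2 & v = layer i (arm_start i j) q.
  move=> ij /mapP[q]; rewrite mem_iota => q_in ->; exists q => //; lia.
split.
- by move=> i; apply/eqP/layer_card.
- move=> i j ij; apply/allP=> _ /(in_arm _ _ _ ij)[q qin ->].
  by apply/eqP/layer_card; [apply: start_lt | have := steps_le i j ij; lia].
- move=> i j ij; rewrite -(layer0 i (arm_start i j)).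
  by apply: path_map_iota => q; apply: layer_step.
- move=> i j ij; rewrite -(layer0 i (arm_start i j)) -(layer0 j (arm_start j i)).
  rewrite !last_map_iota !add0n /layer !odd_double !doubleK.
  apply: disjset_ptrans => [|x b [<-] []]; first by rewrite disjoints1 inE.
  have := ltn_ord x; have := ltn_ord i; have := ltn_ord j; move/ord_neq: ij.
  rewrite /arm_start /arm_steps /rank.
  by do !case: ifP; lia.
- by move=> i j _; rewrite !size_map !size_iota !odd_double.
- by move=> i j /ptrans_inj[/set1_inj].
- move=> i j ij; have steps := steps_le i j ij; have start := start_lt i j ij.
  rewrite map_inj_in_uniq ?iota_uniq // => q q'; rewrite !mem_iota => qin qin'.
  by case/layer_inj=> //; lia.
- move=> i j l ij; apply/negP=> /(in_arm _ _ _ ij)[q qin] /esym.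
  have steps := steps_le i j ij.
  by case/layer_inj=> //; [apply: start_lt | lia | lia | lia].
- move=> i j i' j' v ij ij' /(in_arm _ _ _ ij)[q qin ->] /(in_arm _ _ _ ij')[q' qin'].
  have steps := steps_le i j ij; have steps' := steps_le i' j' ij'.
  case/layer_inj; [exact: start_lt | exact: start_lt | lia | lia | lia |].
  move=> ii qq ss; subst i' q'; split=> //; apply/val_inj => /=.
  move/ord_neq: ij; move/ord_neq: ij' => ij' ij.
  have := ltn_ord i; have := ltn_ord j; have := ltn_ord j'.
  (* Only the arm towards the label [r] reaches the last step [r.*2], where the
     start cannot be read off; elsewhere the start determines [j]. *)
  move: qin qin' ss; rewrite /arm_start /arm_steps /rank; do !case: ifP; lia.
Qed.

End Layers.

(** * Conclusion *)

(** For more than [r + 1] terminals, split off a block of [r + 2] points carrying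
    [r + 2] terminals: this removes equally many points and terminals. *)
Lemma kneser_web m r : has_kneser_web (ground 'I_m r) 'I_m r.+1.
Proof.
elim/ltn_ind: m => m IHm.
case: (ltnP r.+1 m) => [big | m_le]; last first.
  case: (ltnP 2 m) => [m_gt2 | m_le2]; last by apply: kneser_web_direct; right.
  by do 2!eexists; apply: layer_web.
case: (posnP r) => [r0 | r_gt0]; first by apply: kneser_web_direct; left.
have lt_m : m - r.+2 < m by lia.
apply: has_kneser_web_leq (kneser_web_add_block r_gt0 (IHm _ lt_m)).
  by rewrite !card_ground card_sum !card_ord; lia.
by rewrite card_sum !card_ord; lia.
Qed.

(** Forget the terminals in excess of [chi]. For [n < 2k - 1] any two [k]-sets
    meet, the graph has no edges, and a single terminal is all there is. *)
Lemma has_kneser_web_kneser n k (k_gt0 : 0 < k) : k <= n ->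
  has_kneser_web 'I_n 'I_(chi (kneser n k_gt0)) k.
Proof.
move=> le_kn; have chi_le := chi_kneser n k_gt0.
case: (leqP k.*2.-1 n) => [big | small].
  case: k k_gt0 le_kn chi_le big => // r k_gt0 le_kn chi_le big.
  apply: has_kneser_web_leq (kneser_web (n - r.*2) r); rewrite ?card_ground !card_ord; lia.
have chi1 : chi (kneser n k_gt0) <= 1 by lia.
exists (fun _ => [set widen_ord le_kn x | x : 'I_k]), (fun _ _ => [::]).
have ord1E (i j : 'I_(chi (kneser n k_gt0))) : i = j.
  by apply/val_inj => /=; have := ltn_ord i; have := ltn_ord j; lia.
split=> //= i; try by move=> j; rewrite (ord1E i j) eqxx.
apply/eqP; rewrite card_imset ?card_ord // => x y /(congr1 val)/= /val_inj //.
Qed.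

Lemma subdivision_of_kneser_web n k (k_gt0 : 0 < k) m : k <= n ->
  has_kneser_web 'I_n 'I_m k ->
  contains_totally_odd_subdivision (kneser n k_gt0) (complete m).
Proof.
move=> le_kn [phi [arm W]].
have card_k0 : #|[set widen_ord le_kn x | x : 'I_k]| == k.
  by rewrite card_imset ?card_ord // => x y /(congr1 val)/= /val_inj.
pose v0 : {A : {set 'I_n} | #|A| == k} := exist (fun A : {set 'I_n} => #|A| == k) _ card_k0.
pose f A : kneser n k_gt0 := insubd v0 A.
have fK A : A \in ksubset k -> val (f A) = A by move=> kA; rewrite val_insubd [_ == _]kA.
have W' : web predT adj (fun i => f (phi i)) (fun i j => [seq f A | A <- arm i j]).
  apply: (web_map (f := f) (g := id) _ _ _ _ W) => //.
  - by move=> A B kA kB fAB; rewrite -(fK A kA) fAB fK.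
  - by move=> A B kA kB; rewrite /= /kneser_adj !fK.
exact: web_subdivision W'.
Qed.

Theorem theorem1p3 (n k : nat) (k_gt0 : 0 < k) (le_kn : k <= n) :
  contains_totally_odd_subdivision (kneser n k_gt0)
    (complete (chi (kneser n k_gt0))).
Proof. exact/subdivision_of_kneser_web/has_kneser_web_kneser. Qed.
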